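(* Let $\Gamma, L, t$ be positive integers with $t\ge 2$. Consider the $(L,K,\Gamma,M,N)$ multiaccess coded caching system with access topology $\mathfrak{B}$, where $([\Gamma],\mathfrak{B})$ is a $t$-$(\Gamma,L,1)$ design (so $K=|\mathfrak{B}|=\binom{\Gamma}{t}/\binom{L}{t}$). Then the lower convex envelope of the following memory-load tradeoff points is achievable: $$(M,R)=\left(\mu N,\ \frac{\binom{\Gamma}{t+\mu\Gamma}-K\binom{L}{t+\mu\Gamma}-\sum_{i=1}^{\mu\Gamma-1}\binom{L}{t+i}\binom{\Gamma-L}{\mu\Gamma-i}}{\binom{\Gamma}{\mu\Gamma}\binom{L}{t}}\right),$$ for each $\mu=0,\tfrac1\Gamma,\tfrac2\Gamma,\ldots,\tfrac{\Gamma-L}{\Gamma}$.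
   Context: Notation: $[n]=\{1,\dots,n\}$; $\binom{a}{b}=0$ if $b>a$; a sum whose upper limit is smaller than its lower limit is empty and equals $0$. A $t$-$(\Gamma,L,\lambda)$ design is a pair $(\mathcal{X},\mathfrak{B})$ where $\mathcal{X}$ is a set of $\Gamma$ points and $\mathfrak{B}$ is a collection of subsets of $\mathcal{X}$ (blocks), each of size $L$, such that every $t$-subset of $\mathcal{X}$ is contained in exactly $\lambda$ blocks. Multiaccess coded caching system. A server has $N$ files of equal length; there are $\Gamma$ cache-nodes $C_1,\dots,C_\Gamma$, each with a cache of size $M$ files, where the model takes $0\le M\le N/L$, and $K\le N$ cacheless users. The memory ratio is $\mu=M/N$. The access topology $\mathfrak{B}=\{\mathcal{B}_1,\dots,\mathcal{B}_K\}$ consists of distinct $L$-subsets of $[\Gamma]$; user $k$ can read the full content of exactly the cache-nodes $C_\gamma$ with $\gamma\in\mathcal{B}_k$. An $F$-division scheme has two phases. Placement: each file is divided into $F$ packets of equal size, and each cache-node stores at most $MF$ packets of files, without knowledge of the later requests. Delivery: each user requests one file; given the request vector $\mathbf{d}\in[N]^K$, the server broadcasts over an error-free shared link $S_{\mathbf{d}}$ coded packets (each of the size of one packet) to all users, such that each user can recover its requested file from the broadcast and the contents of the cache-nodes it can access. The (worst-case) load is $R=\max_{\mathbf{d}\in[N]^K} S_{\mathbf{d}}/F$. A memory-load point $(M,R)$ is achievable if there is such a scheme with cache-node size $M$ and load at most $R$; points of the lower convex envelope between listed points are obtained by memory-sharing (splitting the files into parts and using the schemes of the listed points on the parts).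
   Formalization: At μ=0 the displayed formula gives the impossible point (0,0); the load there is taken to be K instead. Points of the envelope are achieved exactly when M is rational; for every real M they are achieved with load larger by an arbitrarily small ε>0. *)

(* Defs.v *)
From HB Require Import structures.
From mathcomp Require Import all_boot all_order all_algebra.
From mathcomp Require Import reals.

Set Implicit Arguments.
Unset Strict Implicit.
Unset Printing Implicit Defensive.

Import Order.TTheory GRing.Theory Num.Theory.
Local Open Scope ring_scope.

Definition is_design (t G L lambda : nat) (BB : {set {set 'I_G}}) : Prop :=
  (forall b, b \in BB -> #|b| = L) /\
  (forall T : {set 'I_G}, #|T| = t ->
     #|[set b in BB | T \subset b]| = lambda).

Definition packet (ell : nat) : Type := ell.-tuple bool.

(* [W (n, j)] is the [j]-th packet of file [n]. *)
Definition library (N F ell : nat) : Type := {ffun 'I_N * 'I_F -> packet ell}.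

(* Cached contents: [None] marks the packets that are not available. *)
Definition contents (N F ell : nat) : Type :=
  {ffun 'I_N * 'I_F -> option (packet ell)}.

Definition restrict (N F ell : nat) (A : {set 'I_N * 'I_F})
    (W : library N F ell) : contents N F ell :=
  [ffun p => if p \in A then Some (W p) else None].

Definition file (N F ell : nat) (n : 'I_N) (W : library N F ell) :
    {ffun 'I_F -> packet ell} :=
  [ffun j => W (n, j)].

Definition request (K N : nat) : Type := {ffun 'I_K -> 'I_N}.

(* An F-division scheme for N files, G cache-nodes and K users, user [k]
   reading the cache-nodes in [B k].  Placement is uncoded and does not depend
   on the request; the server may use any (not necessarily linear) code. *)
Record scheme (N G K : nat) (B : 'I_K -> {set 'I_G}) := Scheme {
  division : nat;
  division_gt0 : (0 < division)%N;
  packet_size : nat;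
  packet_size_gt0 : (0 < packet_size)%N;
  placed : 'I_G -> {set 'I_N * 'I_division};
  nb_sent : request K N -> nat;
  encode : forall d : request K N,
    library N division packet_size -> (nb_sent d).-tuple (packet packet_size);
  decode : forall (d : request K N) (k : 'I_K),
    (nb_sent d).-tuple (packet packet_size) ->
    contents N division packet_size ->
    {ffun 'I_division -> packet packet_size};
  decodeP : forall (d : request K N) (k : 'I_K)
      (W : library N division packet_size),
    @decode d k (@encode d W) (restrict (\bigcup_(g in B k) placed g) W)
      = file (d k) W
}.

Definition load (R : realType) (N G K : nat) (B : 'I_K -> {set 'I_G})
    (s : scheme N B) : R :=
  (\max_(d : {ffun 'I_K -> 'I_N}) nb_sent s d)%:R / (division s)%:R.

Definition achievable (R : realType) (N G K : nat) (B : 'I_K -> {set 'I_G})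
    (M rho : R) : Prop :=
  exists s : scheme N B,
    (forall g : 'I_G, #|placed s g|%:R <= M * (division s)%:R) /\
    load R s <= rho.

Lemma not_achievable_0_0 (R : realType) (N G K : nat) (B : 'I_K -> {set 'I_G}) :
  (0 < K)%N -> (0 < N)%N -> ~ achievable N B 0 (0 : R).
Proof.
move=> K0 N0 [s [hM hR]].
pose d : {ffun 'I_K -> 'I_N} := [ffun=> Ordinal N0]; pose k := Ordinal K0.
have F0 : 0 < (division s)%:R :> R by rewrite ltr0n division_gt0.
have S0 : nb_sent s d = 0%N.
  move: hR; rewrite /load ler_pdivrMr // mul0r lern0 -leqn0 => hR.
  by apply/eqP; rewrite -leqn0; apply: leq_trans hR; exact: leq_bigmax.
have P0 g : placed s g = set0.
  by apply/eqP; rewrite -cards_eq0 -(lern0 R); move: (hM g); rewrite mul0r.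
pose W b : library N (division s) (packet_size s) :=
  [ffun=> [tuple of nseq (packet_size s) b]].
have eE : encode (s := s) d (W true) = encode (s := s) d (W false).
  move: (encode _ _) (encode _ _); rewrite S0 => x y.
  by rewrite (tuple0 x) (tuple0 y).
have rE : restrict (\bigcup_(g in B k) placed s g) (W true) =
          restrict (\bigcup_(g in B k) placed s g) (W false).
  apply/ffunP => p; rewrite !ffunE; case: bigcupP => // -[g _].
  by rewrite P0 inE.
have := decodeP (s := s) d k (W true).
rewrite eE rE decodeP => /ffunP /(_ (Ordinal (division_gt0 s))).
rewrite !ffunE => /(congr1 val) /=.
by case: (packet_size s) (packet_size_gt0 s).
Qed.

(* The load at cache ratio m / G (m is the number of cache-nodes holding each
   packet).  The closed expression of the second branch is meant for m >= 1:
   K 'C(L, t + m) counts the (t + m)-subsets contained in a block, which serve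
   no user when m >= 1, but at m = 0 are all that has to be served.  For a
   design 'C(G, t) = K 'C(L, t), so the expression vanishes at m = 0, whereas
   the point (0, 0) is not achievable (not_achievable_0_0); not subtracting
   that count gives 'C(G, t) / 'C(L, t) = K at m = 0. *)
Definition tradeoff_load (R : realType) (t G L K m : nat) : R :=
  if m == 0%N then K%:R
  else ('C(G, t + m)%:R - K%:R * 'C(L, t + m)%:R
          - \sum_(1 <= i < m) 'C(L, t + i)%:R * 'C(G - L, m - i)%:R)
       / ('C(G, m)%:R * 'C(L, t)%:R).

Definition tradeoff_point (R : realType) (t G L K N : nat)
    (m : 'I_(G - L).+1) : R * R :=
  (m%:R / G%:R * N%:R, tradeoff_load R t G L K m).

Definition in_convex_hull (R : realType) (I : finType) (P : I -> R * R)
    (x y : R) : Prop :=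
  exists w : I -> R,
    [/\ forall i, 0 <= w i, \sum_i w i = 1,
        x = \sum_i w i * (P i).1 & y = \sum_i w i * (P i).2].

Definition lower_convex_envelope (R : realType) (I : finType) (P : I -> R * R)
    (x y : R) : Prop :=
  in_convex_hull P x y /\ forall y' : R, in_convex_hull P x y' -> y <= y'.

(* Main.v *)
(* Split every file into packets indexed by an m-subset T of the cache-nodes and
   a t-subset of an L-set; node g stores the packets with g in T.  For a
   (t + m)-set S of nodes contained in no block, let X_S be the sum, over the
   users k with #|S :&: B k| = t, of the packet (S :\: B k, S :&: B k) requested
   by k.  Two blocks sharing t points coincide, so user k has cached every
   summand of X_S but its own, and every packet it misses occurs in some X_S.
   Moreover user k can compute by itself all the X_S with #|S :&: B k| > t; their
   number Q does not depend on k and is the sum in the tradeoff formula.  Hence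
   it suffices to send (number of S) - Q Vandermonde combinations of the X_S
   over a field with 2 ^ G elements.  Memory-sharing is needed between two points
   only, since a point of the convex hull of finitely many points lies on or
   above a segment joining two of them. *)
Require Import Defs.
From mathcomp Require Import all_boot all_order all_algebra all_field.
From mathcomp Require Import reals ring lra zify.
Import Order.TTheory GRing.Theory Num.Theory.
Local Open Scope ring_scope.

Set Implicit Arguments.
Unset Strict Implicit.

(** Vandermonde argument: for [s] in [D], combining the power sums with the coefficients of the
    polynomial vanishing at [alpha] on [D :\ s], of degree below [r], leaves a nonzero multiple of
    [z s] alone. *)
Lemma power_sums_eq0 (E : fieldType) (T : finType) (alpha : T -> E)
    (D : {set T}) (r : nat) (z : T -> E) :
  injective alpha -> (#|D| <= r)%N -> (forall s, s \notin D -> z s = 0) ->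
  (forall j, (j < r)%N -> \sum_s z s * alpha s ^+ j = 0) ->
  forall s, z s = 0.
Proof.
move=> alpha_inj Dr z0 sum0 s; case: (boolP (s \in D)) => [sD|/z0 //].
pose p := \prod_(u <- enum (D :\ s)) ('X - (alpha u)%:P).
have szp : size p = #|D|.
  by rewrite size_prod_XsubC -cardE [in RHS](cardsD1 s) sD.
have : \sum_u z u * p.[alpha u] = 0.
  under eq_bigr => u _ do rewrite horner_coef mulr_sumr.
  rewrite exchange_big big1 // => j _.
  under eq_bigr => u _ do rewrite mulrCA.
  by rewrite -mulr_sumr sum0 ?mulr0 // (leq_trans (ltn_ord j)) // szp.
rewrite (bigD1 s) //= big1 ?addr0; last first.
  move=> u us; case: (boolP (u \in D)) => [uD|/z0 ->]; last by rewrite mul0r.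
  have /rootP -> : root p (alpha u); last by rewrite mulr0.
  rewrite /p -(big_map alpha xpredT (fun a => 'X - a%:P)) root_prod_XsubC.
  by rewrite map_f // mem_enum !inE us.
move/eqP; rewrite mulf_eq0 => /orP[/eqP //|].
rewrite -rootE /p -(big_map alpha xpredT (fun a => 'X - a%:P)).
by rewrite root_prod_XsubC mem_map // mem_enum !inE eqxx.
Qed.

(** * Counting sets by their intersection with a fixed set *)

Section Counting.
Variables (T : finType).
Implicit Types (S b : {set T}).

Lemma card_setID_draws b p q :
  #|[set S : {set T} | (#|S :&: b| == p) && (#|S :\: b| == q)]|
    = ('C(#|b|, p) * 'C(#|T| - #|b|, q))%N.
Proof.
have -> : (#|T| - #|b| = #|~: b|)%N by rewrite [RHS]cardsCs setCK.
rewrite -!cards_draws -cardsX.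
have split (X Y : {set T}) : X \subset b -> Y \subset ~: b ->
    ((X :|: Y) :&: b = X) * ((X :|: Y) :\: b = Y).
  move=> Xb Yb; rewrite setIUl setDUl (setIidPl Xb).
  rewrite (disjoint_setI0 (A := Y)) ?disjoints_subset // setU0.
  have -> : X :\: b = set0 by apply/eqP; rewrite setD_eq0.
  by rewrite set0U; split=> //; apply/setDidPl; rewrite disjoints_subset.
rewrite -(card_in_imset (f := fun u : {set T} * {set T} => u.1 :|: u.2)).
  apply: eq_card => S; rewrite inE; apply/idP/imsetP => [/andP[Sp Sq]|].
    exists (S :&: b, S :\: b); last by rewrite setID.
    by rewrite !inE /= subsetIr Sp Sq setDE subsetIr.
  case=> -[X Y]; rewrite !inE /= => /andP[/andP[Xb Xp] /andP[Yb Yq]] ->.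
  by rewrite !split // Xp.
move=> [X Y] [X' Y']; rewrite !inE /=.
move=> /andP[/andP[Xb _] /andP[Yb _]] /andP[/andP[Xb' _] /andP[Yb' _]] e.
have [eX eY] := split _ _ Xb Yb; have [eX' eY'] := split _ _ Xb' Yb'.
by congr pair; [rewrite -eX e eX' | rewrite -eY e eY'].
Qed.

(** The sets are sorted by [i = #|S :&: b| - t]; the strict bounds on the intersection become
    [1 <= i < m]. *)
Lemma card_draws_meet b t m :
  #|[set S : {set T} | (#|S| == t + m)%N & (t < #|S :&: b| < t + m)%N]|
    = (\sum_(1 <= i < m) 'C(#|b|, t + i) * 'C(#|T| - #|b|, m - i))%N.
Proof.
under eq_bigr => i _ do rewrite -card_setID_draws -sum1dep_card big_mkcond.
rewrite exchange_big -sum1dep_card big_mkcond /=; apply: eq_bigr => S _.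
have cS := cardsID b S.
case: ifPn => [/andP[/eqP Stm /andP[lo hi]]|nS]; last first.
  rewrite big_nat big1 // => i /andP[i1 im]; case: ifP => // /andP[/eqP a /eqP c].
  case/negP: nS; rewrite -cS a c -addnA subnKC ?(ltnW im) // eqxx /=.
  by rewrite -[X in (X < _)%N]addn0 !ltn_add2l i1.
have i1 : (1 <= #|S :&: b| - t)%N by rewrite subn_gt0.
have im : (#|S :&: b| - t < m)%N by rewrite ltn_subLR // ltnW.
rewrite (bigD1_seq (#|S :&: b| - t)%N) ?iota_uniq ?mem_index_iota ?i1 //=.
rewrite subnKC ?(ltnW lo) // eqxx /= big1 ?addn0.
  suff -> : (#|S :\: b| == m - (#|S :&: b| - t))%N by [].
  by rewrite -(eqn_add2l #|S :&: b|) cS Stm; lia.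
move=> i ni; case: ifP => // /andP[/eqP a _]; case/eqP: ni.
by rewrite a addKn.
Qed.

Lemma card_draws_point (g : T) m :
  #|[set S : {set T} | #|S| == m.+1 & g \in S]| = 'C(#|T|.-1, m).
Proof.
have := card_setID_draws [set g] 1 m; rewrite cards1 bin1 mul1n subn1 => <-.
apply: eq_card => S; rewrite !inE (cardsD1 g S).
case: (boolP (g \in S)) => gS.
  by rewrite (setIidPr _) ?sub1set // cards1 eqxx andbT.
rewrite andbF; have -> : S :&: [set g] = set0; last by rewrite cards0.
by apply/eqP; rewrite setI_eq0 disjoint_sym disjoints1.
Qed.

End Counting.

(** * Abstract deliveries, memory-sharing, and passage to schemes on bits *)

Section Delivery.
Variables (N G K : nat) (B : 'I_K -> {set 'I_G}) (A : Type).

(* Packets range over an arbitrary alphabet and are indexed, as are the sent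
   symbols, by arbitrary finite types; every file is placed in the same way, and
   decodability is the injectivity that makes a decoder exist. *)
Definition delivery (F z S : nat) : Prop :=
  exists (I J : finType) (Z : 'I_G -> {set I})
      (enc : request K N -> ('I_N -> I -> A) -> J -> A),
  [/\ #|I| = F, forall g, #|Z g| = z, #|J| = S &
    forall d k (W W' : 'I_N -> I -> A),
      (forall n i, i \in \bigcup_(g in B k) Z g -> W n i = W' n i) ->
      enc d W =1 enc d W' -> W (d k) =1 W' (d k)].

Lemma delivery_uncoded : delivery 1 0 K.
Proof.
exists unit, 'I_K, (fun=> set0), (fun d W k => W (d k) tt).
split=> [|g||d k W W' _ e []]; rewrite ?card_unit ?cards0 ?card_ord //.
Qed.

(** Memory-sharing by juxtaposition: independent copies of the two deliveries run on disjoint parts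
    of every file, the copy number being the first component of each index. *)
Lemma delivery_share F1 z1 S1 F2 z2 S2 c1 c2 :
  delivery F1 z1 S1 -> delivery F2 z2 S2 ->
  delivery (c1 * F1 + c2 * F2) (c1 * z1 + c2 * z2) (c1 * S1 + c2 * S2).
Proof.
move=> [I1 [J1 [Z1 [enc1 [<- cZ1 <- dec1]]]]].
move=> [I2 [J2 [Z2 [enc2 [<- cZ2 <- dec2]]]]].
pose I := (('I_c1 * I1) + ('I_c2 * I2))%type.
pose Z g : {set I} := [set i : I | match i with
  | inl p => p.2 \in Z1 g | inr p => p.2 \in Z2 g end].
pose enc d (W : 'I_N -> I -> A) (j : ('I_c1 * J1) + ('I_c2 * J2)) :=
  match j with
  | inl p => enc1 d (fun n i => W n (inl (p.1, i))) p.2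
  | inr p => enc2 d (fun n i => W n (inr (p.1, i))) p.2 end.
exists I, (('I_c1 * J1) + ('I_c2 * J2))%type, Z, enc; split.
- by rewrite card_sum !card_prod !card_ord.
- move=> g; have -> : Z g = inl @: setX setT (Z1 g) :|: inr @: setX setT (Z2 g).
    apply/setP => -[] [a i]; rewrite !inE /=.
      rewrite mem_imset ?inE //=; last by move=> ? ? [].
      by apply/esym/orb_idr => /imsetP[].
    rewrite orbC mem_imset ?inE //=; last by move=> ? ? [].
    by apply/esym/orb_idr => /imsetP[].
  rewrite cardsU disjoint_setI0 ?cards0 ?subn0.
    by rewrite !card_imset ?cardsX ?cardsT ?card_ord ?cZ1 ?cZ2 // => ? ? [].
  rewrite disjoint_subset; apply/subsetP => _ /imsetP[u _ ->].
  by rewrite inE; apply/imsetP => -[].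
- by rewrite card_sum !card_prod !card_ord.
move=> d k W W' eW eE [] [a i].
  apply: (dec1 d k (fun n i => W n (inl (a, i))) (fun n i => W' n (inl (a, i)))).
    move=> n i' /bigcupP[g gk ig]; apply: eW; apply/bigcupP.
    by exists g => //; rewrite inE.
  by move=> j; apply: (eE (inl (a, j))).
apply: (dec2 d k (fun n i => W n (inr (a, i))) (fun n i => W' n (inr (a, i)))).
  move=> n i' /bigcupP[g gk ig]; apply: eW; apply/bigcupP.
  by exists g => //; rewrite inE.
by move=> j; apply: (eE (inr (a, j))).
Qed.

End Delivery.

Arguments delivery N {G K} B A F z S.

Lemma leq_card_inj (T T' : finType) :
  (#|T| <= #|T'|)%N -> exists f : T -> T', injective f.
Proof.
move=> le; exists (fun x => enum_val (widen_ord le (enum_rank x))) => x y.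
by move/enum_val_inj/(congr1 val) => /= /val_inj; apply: enum_rank_inj.
Qed.

Lemma scheme_of_delivery (N G K : nat) (B : 'I_K -> {set 'I_G}) (A : finType)
    (ell F z S : nat) :
  (0 < ell)%N -> #|A| = (2 ^ ell)%N -> (0 < F)%N -> delivery N B A F z S ->
  exists s : scheme N B, [/\ division s = F, forall g, #|placed s g| = (N * z)%N
    & forall d, nb_sent s d = S].
Proof.
move=> ell0 cA F0 [I [J [Z [enc [cI cZ cJ dec]]]]].
have cP : #|{: packet ell}| = #|A| by rewrite card_tuple card_bool.
have [phi phi_inj] : exists f : packet ell -> A, injective f.
  by apply: leq_card_inj; rewrite cP.
have [psi phiK psiK] : bijective phi by apply: inj_card_bij; rewrite ?cP.
have I0 : (0 < #|I|)%N by rewrite cI.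
pose placed g := [set p : 'I_N * 'I_#|I| | enum_val p.2 \in Z g].
pose word (W : library N #|I| ell) n i := phi (W (n, enum_rank i)).
pose encode (d : request K N) (W : library N #|I| ell) :=
  [tuple psi (enc d (word W) (enum_val j)) | j < #|J|].
(* The decoder picks any library consistent with what user [k] sees; it may differ from the true
   one, but by [dec] not on the requested file. The constant default is never reached on actual
   transmissions. *)
pose decode d k (y : #|J|.-tuple (packet ell)) (c : contents N #|I| ell) :=
  if [pick W : {ffun 'I_N * 'I_#|I| -> ell.-tuple bool} |
       (encode d W == y) && (restrict (\bigcup_(g in B k) placed g) W == c)]
  is Some W then file (d k) W else [ffun=> [tuple of nseq ell true]].
have decodeP d k W :
    decode d k (encode d W) (restrict (\bigcup_(g in B k) placed g) W)
      = file (d k) W.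
  rewrite /decode; case: pickP => [W'|/(_ W)]; last by rewrite !eqxx.
  move=> /andP[/eqP eE /eqP eR]; apply/ffunP => i; rewrite !ffunE.
  apply: phi_inj; rewrite -[i]enum_valK; move: (enum_val i).
  apply: (dec d k (word W') (word W)) => [n i' /bigcupP[g gk ig]|j].
    move/ffunP: eR => /(_ (n, enum_rank i')); rewrite !ffunE.
    case: bigcupP => [_ [e]|[]]; first by rewrite /word e.
    by exists g => //; rewrite inE enum_rankK.
  move: eE => /(congr1 (fun u => tnth u (enum_rank j))).
  by rewrite !tnth_mktuple enum_rankK => /(can_inj psiK).
exists (@Scheme N G K B #|I| I0 ell ell0 placed (fun=> #|J|) encode decode decodeP).
split=> //= g; rewrite -(cZ g).
have -> : placed g = setX setT (enum_rank @: Z g).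
  apply/setP => -[n i]; rewrite !inE /= -{2}[i]enum_valK mem_imset //.
  exact: enum_rank_inj.
by rewrite cardsX cardsT card_ord card_imset //; apply: enum_rank_inj.
Qed.

Lemma achievable_share (R : realType) (N G K : nat) (B : 'I_K -> {set 'I_G})
    (A : finType) (ell F1 z1 S1 F2 z2 S2 : nat) (q : rat) :
  (0 < ell)%N -> #|A| = (2 ^ ell)%N -> (0 < F1)%N -> (0 < F2)%N ->
  delivery N B A F1 z1 S1 -> delivery N B A F2 z2 S2 ->
  0 <= q <= 1 ->
  achievable N B
    (ratr q * (N%:R * z1%:R / F1%:R) + (1 - ratr q) * (N%:R * z2%:R / F2%:R))
    (ratr q * (S1%:R / F1%:R) + (1 - ratr q) * (S2%:R / F2%:R) : R).
Proof.
move=> ell0 cA F10 F20 del1 del2 /andP[q0 q1].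
have [a [b [b0 [ab qE]]]] : exists a b : nat,
    (0 < b)%N /\ (a <= b)%N /\ ratr q = a%:R / b%:R :> R.
  exists `|numq q|%N, `|denq q|%N.
  have dq : (`|denq q|%N : int) = denq q by rewrite gez0_abs // ltW ?denq_gt0.
  have nq : (`|numq q|%N : int) = numq q by rewrite gez0_abs // numq_ge0.
  split; first by rewrite absz_gt0 denq_neq0.
  split; last by rewrite /ratr -nq -dq.
  rewrite -lez_nat dq nq; move: q1; rewrite -[q in q <= 1]divq_num_den.
  by rewrite ler_pdivrMr ?ltr0z ?denq_gt0 // mul1r ler_int.
(* With [q = a / b], these numbers of copies give [b * F1 * F2] packets per file, of which the first
   delivery handles exactly the fraction [q]. *)
have [|s [sF sz sS]] := scheme_of_delivery ell0 cA _
    (delivery_share (a * F2) ((b - a) * F1) del1 del2).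
  by move: (muln_gt0 F1 F2) F10 F20; nia.
have nz : (F1%:R != 0 :> R) * (F2%:R != 0 :> R) * (b%:R != 0 :> R).
  by rewrite !pnatr_eq0 -!lt0n.
have sFE : (division s)%:R = b%:R * F1%:R * F2%:R :> R.
  rewrite sF -!natrM; congr _%:R.
  by rewrite -[in RHS](subnK ab); ring.
exists s; split=> [g|].
  rewrite sz sFE qE le_eqVlt; apply/orP; left; apply/eqP.
  by rewrite natrM natrD !natrM natrB //; field; rewrite !nz.
apply: (@le_trans _ _ (((a * F2) * S1 + ((b - a) * F1) * S2)%N%:R / (division s)%:R)).
  rewrite ler_wpM2r ?invr_ge0 ?ler0n // ler_nat.
  by apply/bigmax_leqP => d _; rewrite sS.
rewrite sFE qE le_eqVlt; apply/orP; left; apply/eqP.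
by rewrite natrD !natrM natrB //; field; rewrite !nz.
Qed.

(** * Blocks of a design and the coded delivery built on them *)

Section Design.
Variables (G L t K : nat) (B : 'I_K -> {set 'I_G}).
Hypothesis card_block : forall k, #|B k| = L.
Hypothesis card_blocks_above :
  forall T : {set 'I_G}, #|T| = t -> #|[set k | T \subset B k]| = 1%N.

Lemma block_eq (T : {set 'I_G}) k k' :
  (t <= #|T|)%N -> T \subset B k -> T \subset B k' -> k = k'.
Proof.
rewrite -bin_gt0 -cards_draws => /card_gt0P[S]; rewrite inE => /andP[ST /eqP cS].
move=> Tk Tk'; have /eqP/cards1P[k0 e] := card_blocks_above cS.
have mem l : T \subset B l -> l = k0.
  by move=> Tl; apply/set1P; rewrite -e inE (subset_trans ST).
by rewrite (mem k) // (mem k').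
Qed.

Definition uncovered (s : nat) :=
  [set S : {set 'I_G} | (#|S| == s) && ~~ [exists k, S \subset B k]].

(** Since [t <= s], an [s]-set lies in at most one block, so counting block by block counts each
    covered set once. *)
Lemma card_uncovered (s : nat) :
  (t <= s)%N -> 'C(G, s) = (#|uncovered s| + K * 'C(L, s))%N.
Proof.
move=> ts; have -> : (K * 'C(L, s) = \sum_k \sum_(S : {set 'I_G} | #|S| == s) (S \subset B k))%N.
  rewrite -[K in LHS]card_ord -sum_nat_const; apply: eq_bigr => k _.
  rewrite -(card_block k) -cards_draws -sum1dep_card big_mkcondl /=.
  by apply: eq_bigr => S _; case: (_ \subset _).
rewrite exchange_big -[in LHS](card_ord G) -card_draws -!sum1dep_card.
rewrite [X in (X + _)%N]big_mkcondr /= -big_split /=; apply: eq_bigr => S /eqP cS.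
case: existsP => [[k Sk]|nS] /=.
  rewrite (bigD1 k) //= Sk big1 // => l lk; apply/eqP; rewrite eqb0.
  by apply: contra lk => Sl; apply/eqP; apply: (block_eq (T := S)); rewrite ?cS.
by rewrite big1 ?addn0 // => k _; apply/eqP; rewrite eqb0; apply/negP => Sk; case: nS; exists k.
Qed.

Lemma card_design : 'C(G, t) = (K * 'C(L, t))%N.
Proof.
rewrite card_uncovered // (_ : uncovered t = set0) ?cards0 //.
apply/setP => S; rewrite !inE; apply/andP => -[/eqP /card_blocks_above cS].
have /card_gt0P[k] : (0 < #|[set k | S \subset B k]|)%N by rewrite cS.
by rewrite inE => Sk /existsP[]; exists k.
Qed.

(** When [S] meets [B k] in more than [t] points, [B k] is the only block that can contain [S];
    being uncovered then just means not lying inside [B k]. *)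
Lemma known_uncovered k (m : nat) :
  [set S in uncovered (t + m)%N | (t < #|S :&: B k|)%N] =
  [set S : {set 'I_G} | (#|S| == t + m)%N & (t < #|S :&: B k| < t + m)%N].
Proof.
apply/setP => S; rewrite !inE; case: eqP => //= cS; rewrite andbC.
case: ltnP => //= tS; apply/idP/idP => [nS|].
  rewrite -cS ltn_neqAle subset_leq_card ?subsetIl // andbT.
  apply: contra nS => /eqP e; apply/existsP; exists k.
  by apply/setIidPl/eqP; rewrite eqEcard subsetIl e leqnn.
apply: contraL => /existsP[l Sl]; rewrite -leqNgt.
rewrite (block_eq (T := S :&: B k) (k := k) (k' := l)) ?subsetIr ?(ltnW tS) //.
  by rewrite (setIidPl Sl) cS.
by rewrite subIset ?Sl.
Qed.

Lemma card_known k (m : nat) :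
  #|[set S in uncovered (t + m)%N | (t < #|S :&: B k|)%N]|
    = (\sum_(1 <= i < m) 'C(L, t + i) * 'C(G - L, m - i))%N.
Proof. by rewrite known_uncovered card_draws_meet card_block card_ord. Qed.

(** Gives all blocks a common index set, so that packet labels do not depend on the user who
    requests the file. *)
Lemma block_enum : exists beta : 'I_K -> 'I_L -> 'I_G,
  (forall k, injective (beta k)) /\ forall k, beta k @: setT = B k.
Proof.
exists (fun k i => enum_val (cast_ord (esym (card_block k)) i)).
have inj k : injective (fun i => enum_val (cast_ord (esym (card_block k)) i)).
  by move=> i j /enum_val_inj /cast_ord_inj.
split=> // k; apply/eqP; rewrite eqEcard card_imset // cardsT card_ord.
apply/andP; split; last by rewrite card_block.
by apply/subsetP => _ /imsetP[i _ ->]; apply: enum_valP.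
Qed.

Lemma delivery_design (N m : nat) (E : finFieldType) :
  (0 < m)%N -> (2 ^ G <= #|E|)%N ->
  delivery N B E ('C(G, m) * 'C(L, t)) ('C(G.-1, m.-1) * 'C(L, t))
    (#|uncovered (t + m)%N|
       - \sum_(1 <= i < m) 'C(L, t + i) * 'C(G - L, m - i))%N.
Proof.
move=> m0 cE; have [beta [beta_inj beta_img]] := block_enum.
have [alpha alpha_inj] : exists f : {set 'I_G} -> E, injective f.
  by apply: leq_card_inj; rewrite -cardsT -powersetT card_powerset cardsT card_ord.
set U := uncovered (t + m)%N; set Q := (\sum_(1 <= i < m) _)%N.
pose I := {p : {set 'I_G} * {set 'I_L} | (#|p.1| == m) && (#|p.2| == t)}.
(* The default 0 is for pairs of wrong sizes; none arises in [X] below when [S] is in [U]. *)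
pose word (W : 'I_N -> I -> E) n T C := oapp (W n) 0 (insub (T, C)).
pose X (d : request K N) W (S : {set 'I_G}) :=
  \sum_(k | #|S :&: B k| == t) word W (d k) (S :\: B k) (beta k @^-1: S).
pose enc d W (j : 'I_(#|U| - Q)) := \sum_(S in U) X d W S * alpha S ^+ j.
exists I, 'I_(#|U| - Q), (fun g => [set p : I | g \in (val p).1]), enc.
have card_I (P : pred {set 'I_G}) :
    #|[set p : I | P (val p).1]| =
      (#|[set T : {set 'I_G} | #|T| == m & P T]| * 'C(L, t))%N.
  rewrite -[X in 'C(X, t)]card_ord -card_draws -cardsX.
  rewrite -(card_imset _ (val_inj (sT := I))); apply: eq_card => -[T C].
  rewrite !inE /=; apply/imsetP/idP => [[[q qP]]|/andP[/andP[Tm PT] Ct]].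
    by rewrite inE /= => + e; move: qP; rewrite -e /= => /andP[-> ->] ->.
  have pP : (#|(T, C).1| == m) && (#|(T, C).2| == t) by rewrite /= Tm.
  by exists (Sub (T, C) pP); rewrite ?inE SubK.
split.
- rewrite -cardsT -[in RHS](card_ord G) -card_draws.
  have := card_I xpredT; rewrite (_ : [set p | _] = setT).
    by move->; congr (_ * _)%N; apply: eq_card => T; rewrite !inE andbT.
  by apply/setP => p; rewrite !inE.
- by move=> g; rewrite (card_I (fun T => g \in T)) -{1}(prednK m0) card_draws_point card_ord.
- by rewrite card_ord.
move=> d k W W' eW eE.
have meet_known n (T : {set 'I_G}) C : ~~ [disjoint T & B k] ->
    word W n T C = word W' n T C.
  move=> /pred0Pn[g /andP[/= gT gk]]; rewrite /word.
  case: insubP => //= p _ pE; apply: eW; apply/bigcupP; exists g => //.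
  by move: gT; rewrite inE -[T]/((T, C).1) -pE.
(* A point of [S :&: B k] outside [B k'] is a node of [S :\: B k'] that user [k] reads, so the
   summand of [k'] is cached. *)
have other_known S k' : ~~ (S :&: B k \subset B k') ->
    word W (d k') (S :\: B k') (beta k' @^-1: S)
      = word W' (d k') (S :\: B k') (beta k' @^-1: S).
  move=> /subsetPn[g /setIP[gS gk] gk']; apply: meet_known.
  by apply/pred0Pn; exists g; rewrite /= inE gS gk gk'.
(* Outside [D], user [k] knows [X d W S]: a block meeting [S] in exactly [t] points cannot contain
   the larger set [S :&: B k]. *)
pose D := [set S in U | (#|S :&: B k| <= t)%N].
have cD : (#|D| <= #|U| - Q)%N.
  rewrite /Q -(card_known k m) -/U leq_subRL; last first.
    by apply: subset_leq_card; apply/subsetP => S; rewrite inE => /andP[].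
  rewrite -(cardsID [set S : {set 'I_G} | (t < #|S :&: B k|)%N] U).
  apply: leq_add; apply: subset_leq_card; apply/subsetP => S; rewrite !inE //.
  by rewrite -leqNgt andbC.
have XE S : S \in U -> X d W S = X d W' S.
  pose z S := if S \in U then X d W S - X d W' S else 0.
  suff /(_ S) : forall S, z S = 0.
    by rewrite /z => + SU; rewrite SU => /eqP; rewrite subr_eq0 => /eqP.
  (* The transmitted symbols are power sums, as many as the upper bound on [#|D|], so they determine
     the remaining unknown sums. *)
  apply: (power_sums_eq0 alpha_inj cD) => [s sD|j jlt].
    rewrite /z; case: ifP => // sU; apply/eqP; rewrite subr_eq0; apply/eqP.
    apply: eq_bigr => k' /eqP ck'; apply: other_known.
    apply: contra sD => sub; rewrite inE sU -ck' subset_leq_card //.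
    by rewrite subsetI subsetIl.
  have := eE (Ordinal jlt); rewrite /enc /= => /eqP; rewrite -subr_eq0 => /eqP e.
  rewrite -[RHS]e -sumrB [RHS]big_mkcond; apply: eq_bigr => s _; rewrite /z.
  by case: ifP; rewrite ?mul0r ?mulrBl.
case=> -[T C] pTC; have /andP[/= /eqP cT /eqP cC] := pTC.
have wordE V : V (d k) (exist _ (T, C) pTC) = word V (d k) T C.
  by rewrite /word insubT.
rewrite !wordE; case: (boolP [disjoint T & B k]) => [Tk|]; last exact: meet_known.
pose S := T :|: beta k @: C.
have Ck : beta k @: C \subset B k by rewrite -(beta_img k) imsetS ?subsetT.
have Sk : S :&: B k = beta k @: C.
  by rewrite setIUl (disjoint_setI0 Tk) set0U; apply/setIidPl.
have SDk : S :\: B k = T.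
  rewrite setDUl (_ : beta k @: C :\: B k = set0) ?setU0.
    by apply/setDidPl.
  by apply/eqP; rewrite setD_eq0.
have SC : beta k @^-1: S = C.
  apply/setP => i; have ik : beta k i \in B k by rewrite -(beta_img k) imset_f.
  by rewrite -[RHS](mem_imset _ _ (beta_inj k)) -Sk in_setI ik andbT inE.
have cSk : #|S :&: B k| = t by rewrite Sk card_imset.
(* A block containing [S] shares [t] points with [B k], hence equals it; then [T] would be empty,
   against [0 < m]. *)
have SU : S \in U.
  rewrite inE -(cardsID (B k) S) cSk SDk cT eqxx /=; apply/existsP => -[l Sl].
  have kl : k = l.
    apply: (block_eq (T := S :&: B k)); rewrite ?cSk ?subsetIr //.
    by rewrite subIset ?Sl.
  have : T = set0 by rewrite -SDk; apply/eqP; rewrite setD_eq0 kl.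
  by move=> T0; rewrite T0 cards0 in cT; rewrite -cT in m0.
(* All summands but that of [k] agree for [W] and [W'] and cancel, since no other block contains the
   [t] points of [S :&: B k]. *)
have := XE S SU; rewrite /X (bigD1 k) ?cSk //= [X in _ = X -> _](bigD1 k) ?cSk //=.
rewrite SDk SC (eq_bigr (fun k' => word W' (d k') (S :\: B k') (beta k' @^-1: S))).
  exact: addIr.
move=> k' /andP[_ nk]; apply: other_known; apply: contra nk => sub.
by apply/eqP/esym/(block_eq (T := S :&: B k)); rewrite ?cSk ?subsetIr.
Qed.

End Design.

(** * Planar convex hulls of finitely many points *)

Section Hull.
Variables (R : realType) (I : finType) (P : I -> R * R).

(* If no such segment existed, the line of slope [- c] through (x, y) chosen
   below would pass strictly under the points of abscissa at most x and weakly
   under the others, so that all weights would vanish.  When x_i = x_j = x,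
   [l] is the junk value 0 / 0 = 0. *)
Lemma hull_below_segment (x y : R) : in_convex_hull P x y ->
  exists i j l,
  [/\ (P i).1 <= x <= (P j).1, l = ((P j).1 - x) / ((P j).1 - (P i).1),
      x = l * (P i).1 + (1 - l) * (P j).1
    & l * (P i).2 + (1 - l) * (P j).2 <= y].
Proof.
move=> [w [w0 w1 xE yE]].
pose a i := (P i).1 - x; pose b i := (P i).2 - y.
have sum_a : \sum_i w i * a i = 0.
  under eq_bigr => i _ do rewrite mulrBr.
  by rewrite sumrB -xE -mulr_suml w1 mul1r subrr.
have sum_b : \sum_i w i * b i = 0.
  under eq_bigr => i _ do rewrite mulrBr.
  by rewrite sumrB -yE -mulr_suml w1 mul1r subrr.
(* Used in turn for [- a], [b], [b + c * a] and [a] to force weights to vanish. *)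
have sum0 (h : I -> R) : \sum_i w i * h i = 0 ->
    (forall i, w i != 0 -> 0 <= h i) -> forall i, h i != 0 -> w i = 0.
  move=> sh h0 i hi; apply: contraNeq hi => wi.
  have wh0 j : predT j -> 0 <= w j * h j.
    by have [->|wj] := eqVneq (w j) 0; rewrite ?mul0r // mulr_ge0 // h0.
  have /eqP := psumr_eq0P wh0 sh (isT : predT i).
  by rewrite mulf_eq0 (negPf wi).
have not_all0 : ~ (forall i, w i = 0).
  move=> w_eq0; move: w1; rewrite big1 // => /eqP.
  by rewrite eq_sym oner_eq0.
case: (pickP [pred i | (a i == 0) && (b i <= 0)]) => [i /andP[/= /eqP ai bi]|zero].
  have xi : (P i).1 = x by apply/eqP; rewrite -subr_eq0 -/(a i) ai.
  exists i, i, 0; rewrite xi lexx subrr mul0r subr0 !mul0r !add0r !mul1r.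
  by split=> //; rewrite -subr_le0.
(* Divided by [a j - a i], the last quantity is the signed height over [y] of the segment from [P i]
   to [P j] at abscissa [x]. *)
case: (pickP [pred p : I * I | [&& a p.1 < 0, 0 < a p.2 &
    a p.2 * b p.1 - a p.1 * b p.2 <= 0]]) => [[i j] /and3P[/= ai aj ab]|pairs].
  have xi : (P i).1 < x by rewrite -subr_lt0.
  have xj : x < (P j).1 by rewrite -subr_gt0.
  exists i, j, (((P j).1 - x) / ((P j).1 - (P i).1)).
  have d0 : 0 < (P j).1 - (P i).1 by rewrite subr_gt0 (lt_trans xi).
  have dn : (P j).1 - (P i).1 != 0 by rewrite gt_eqF.
  split=> //; [by rewrite !ltW | by field |]; rewrite -subr_le0.
  have -> : ((P j).1 - x) / ((P j).1 - (P i).1) * (P i).2 +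
      (1 - ((P j).1 - x) / ((P j).1 - (P i).1)) * (P j).2 - y =
      (a j * b i - a i * b j) / ((P j).1 - (P i).1).
    by rewrite /a /b; field.
  by rewrite pmulr_lle0 ?invr_gt0.
exfalso.
have b_zero i : a i = 0 -> 0 < b i.
  by move=> ai; have := zero i; rewrite /= ai eqxx /= leNgt => /negbFE.
case: (pickP [pred j | 0 < a j]) => [j0 pj0|pos]; last first.
  have w_neg i : a i != 0 -> w i = 0.
    rewrite -oppr_eq0; apply: (sum0 (fun i => - a i)) => [|k _].
      by under eq_bigr => k _ do rewrite mulrN; rewrite sumrN sum_a oppr0.
    by rewrite oppr_ge0 leNgt; have /= -> := pos k.
  apply: not_all0 => i; have [ai|/w_neg //] := eqVneq (a i) 0.
  apply: (sum0 b) => [//|k wk|]; last by rewrite gt_eqF ?b_zero.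
  apply/ltW/b_zero; apply: contraNeq wk => /w_neg ->; exact: eqxx.
case: (@arg_maxP _ _ _ j0 [pred j | 0 < a j] (fun j => - b j / a j) pj0).
move=> j /= aj maxj; pose c := - b j / a j.
have c_pos i : 0 < a i -> 0 <= b i + c * a i.
  move=> ai; have /= := maxj i ai; rewrite -/c ler_pdivrMr //.
  by rewrite -subr_ge0 opprK addrC.
have c_neg i : a i <= 0 -> 0 < b i + c * a i.
  rewrite le_eqVlt => /orP[/eqP ai|ai]; first by rewrite ai mulr0 addr0 b_zero.
  have := pairs (i, j); rewrite /= ai aj /= leNgt => /negbFE.
  rewrite -(pmulr_lgt0 _ (x := (a j)^-1)) ?invr_gt0 //.
  by congr (0 < _); rewrite /c; field; rewrite gt_eqF.
have w_np i : a i <= 0 -> w i = 0.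
  move=> ai; apply: (sum0 (fun i => b i + c * a i)).
  - under eq_bigr => k _ do rewrite mulrDr mulrCA.
    by rewrite big_split /= -mulr_sumr sum_a sum_b mulr0 addr0.
  - by move=> k _; case: (ltP 0 (a k)) => [/c_pos //|/c_neg/ltW].
  - by rewrite gt_eqF ?c_neg.
apply: not_all0 => i; case: (leP (a i) 0) => [/w_np //|ai].
apply: (sum0 a) => [//|k|]; last by rewrite gt_eqF.
by case: (leP (a k) 0) => [/w_np ->|/ltW //]; rewrite eqxx.
Qed.

End Hull.

(** * Assembly: the tradeoff points, then their convex envelope *)

Unset Implicit Arguments.

(* A real weight of a memory-sharing is only a limit of splittings of a file
   into finitely many packets: exact achievability is claimed at rational M,
   and achievability up to an arbitrarily small load at every real M. *)
Theorem theorem1 (R : realType) (G L t K N : nat)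
    (B : 'I_K -> {set 'I_G})
    (hG : (0 < G)%N) (hL : (0 < L)%N) (ht : (2 <= t)%N)
    (htL : (t <= L)%N) (hLG : (L <= G)%N) (hKN : (K <= N)%N)
    (hinj : injective B)
    (hdesign : is_design t L 1 [set B k | k : 'I_K]) :
  ('C(G, t) = K * 'C(L, t))%N /\
  forall M rho : R,
    lower_convex_envelope (tradeoff_point R t (G := G) (L := L) K N) M rho ->
    ((exists q : rat, M = ratr q) -> achievable N B M rho) /\
    (forall eps : R, 0 < eps -> achievable N B M (rho + eps)).
Proof.
have [blockL uniqB] := hdesign.
have cardB k : #|B k| = L by rewrite blockL ?imset_f.
have aboveB (T : {set 'I_G}) : #|T| = t -> #|[set k | T \subset B k]| = 1%N.
  move=> /uniqB <-; rewrite -(card_imset _ hinj); apply: eq_card => b.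
  rewrite !inE; apply/imsetP/andP => [[k]|[/imsetP[k _ ->] Tk]].
    by rewrite inE => Tk ->; rewrite imset_f.
  by exists k; rewrite ?inE.
have K_eq : 'C(G, t) = (K * 'C(L, t))%N by apply: card_design aboveB.
split=> // M rho [hull _].
have K0 : (0 < K)%N.
  by have := bin_gt0 G t; rewrite K_eq (leq_trans htL hLG) muln_gt0 => /andP[].
have CL0 : (0 < 'C(L, t))%N by rewrite bin_gt0.
(* A symbol of this field is a packet of [G] bits, and the field has a distinct evaluation point for
   every subset of the [G] nodes. *)
have [E _ cE] := pPrimePowerField (isT : prime 2) hG.
have points (m : 'I_(G - L).+1) : exists F z S, [/\ (0 < F)%N, delivery N B E F z S &
    tradeoff_point R t K N m = (N%:R * z%:R / F%:R, S%:R / F%:R)].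
  have [m0|m_neq0] := eqVneq (m : nat) 0%N.
    exists 1%N, 0%N, K; split=> //; first exact: delivery_uncoded.
    by rewrite /tradeoff_point /tradeoff_load m0 eqxx !mul0r mulr0 mul0r divr1.
  have m_gt0 : (0 < m)%N by rewrite lt0n.
  have mG : (m <= G)%N by rewrite (leq_trans _ (leq_subr L G)) // -ltnS.
  have del : delivery N B E _ _ _ :=
    delivery_design cardB aboveB N m_gt0 (eq_leq (esym cE)).
  do 3!eexists; split; [|exact: del|].
    by rewrite muln_gt0 CL0 bin_gt0 mG.
  have nz : (G%:R != 0 :> R) * ('C(G, m)%:R != 0 :> R) * ('C(L, t)%:R != 0 :> R).
    by rewrite !pnatr_eq0 -!lt0n bin_gt0.
  rewrite /tradeoff_point /tradeoff_load (negPf m_neq0); congr pair.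
    have diag : 'C(G.-1, m.-1)%:R = m%:R * 'C(G, m)%:R / G%:R :> R.
      by apply: canRL (mulfK _) _; rewrite ?nz // -!natrM mulnC mul_bin_diag prednK.
    by rewrite !natrM diag; field; rewrite !nz.
  (* Ensures that the natural-number subtraction in the number of sent symbols is not truncated. *)
  have le_U : (\sum_(1 <= i < m) 'C(L, t + i) * 'C(G - L, m - i)
      <= #|uncovered B (t + m)|)%N.
    rewrite -(card_known cardB aboveB (Ordinal K0)).
    by apply: subset_leq_card; apply/subsetP => S; rewrite inE => /andP[].
  rewrite natrM natrB // natr_sum; congr (_ / _); congr (_ - _); last first.
    by apply: eq_bigr => i _; rewrite natrM.
  rewrite (card_uncovered cardB aboveB (s := t + m)) ?leq_addr //.
  by rewrite natrD natrM addrK.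
have share m1 m2 q : 0 <= q <= 1 ->
    achievable N B
      (ratr q * (tradeoff_point R t (G := G) (L := L) K N m1).1 +
       (1 - ratr q) * (tradeoff_point R t (G := G) (L := L) K N m2).1)
      (ratr q * (tradeoff_point R t (G := G) (L := L) K N m1).2 +
       (1 - ratr q) * (tradeoff_point R t (G := G) (L := L) K N m2).2).
  have [F1 [z1 [S1 [F10 del1 ->]]]] := points m1.
  have [F2 [z2 [S2 [F20 del2 ->]]]] := points m2.
  exact: achievable_share hG cE F10 F20 del1 del2.
pose P := tradeoff_point R t (G := G) (L := L) K N.
have rat01 (q : rat) : (0 <= (ratr q : R) <= 1) = (0 <= q <= 1).
  have one : 1 = ratr 1 :> R by rewrite rmorph1.
  by rewrite ler0q [in LHS]one ler_rat.
have [i [j [l [/andP[xi xj] lE ME rhoE]]]] := hull_below_segment (P := P) hull.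
have l01 : 0 <= l <= 1.
  have d0 : 0 <= (P j).1 - (P i).1 by rewrite subr_ge0 (le_trans xi).
  rewrite lE; apply/andP; split; first by rewrite divr_ge0 // subr_ge0.
  have [->|dn] := eqVneq ((P j).1 - (P i).1) 0; first by rewrite invr0 mulr0.
  by rewrite ler_pdivrMr ?lt_def ?dn ?d0 // mul1r lerD2l lerN2.
split=> [[q Mq]|eps eps0].
  have P_rat m : (P m).1 = ratr (m%:R / G%:R * N%:R).
    by rewrite rmorphM fmorph_div /= !ratr_nat.
  (* The abscissas of the tradeoff points are rational, so a rational memory forces a rational
     weight. *)
  have lq : l = ratr ((j%:R / G%:R * N%:R - q) /
      (j%:R / G%:R * N%:R - i%:R / G%:R * N%:R)).
    by rewrite lE Mq !P_rat fmorph_div !rmorphB.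
  move: l01 rhoE ME; rewrite {l lE}lq rat01.
  move=> /share ach rhoE ME; have [s [sM sR]] := ach i j.
  exists s; split=> [g|]; first by rewrite ME; apply: sM.
  exact: le_trans sR rhoE.
(* Rounding [l] upwards moves weight to the left endpoint, so the memory stays at most [M]; only the
   load can grow, by at most [eps]. *)
have [q [lq ql q01]] : exists q : rat, [/\ l <= ratr q,
    (ratr q - l) * ((P i).2 - (P j).2) <= eps & 0 <= q <= 1].
  have /andP[l0] := l01; rewrite le_eqVlt => /orP[/eqP l1|l1].
    by exists 1; rewrite l1 rmorph1 subrr mul0r (ltW eps0) lexx ler01.
  (* Adding 1 keeps the denominator positive when the two loads coincide. *)
  pose e := eps / (`|(P i).2 - (P j).2| + 1).
  have e0 : 0 < e by rewrite divr_gt0 // ltr_wpDl.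
  have [|q] := @rat_in_itvoo R l (Num.min 1 (l + e)).
    by rewrite lt_min l1 ltrDl.
  rewrite in_itv /= lt_min => /and3P[lq q1 qe]; exists q; split; first exact: ltW.
    apply: le_trans (_ : e * (`|(P i).2 - (P j).2| + 1) <= _); last first.
      by rewrite divfK // gt_eqF // ltr_wpDl.
    apply: le_trans (ler_norm _) _; rewrite normrM ler_pM //; last first.
      by rewrite lerDl.
    by rewrite ger0_norm ?subr_ge0 ?ltW // ltrBlDl.
  by rewrite -rat01 (le_trans l0) !ltW.
have [s [sM sR]] := share i j q q01.
exists s; split=> [g|].
  apply: le_trans (sM g) _; rewrite ler_wpM2r ?ler0n // [leRHS]ME -/P.
  have : 0 <= (ratr q - l) * ((P j).1 - (P i).1).
    by rewrite mulr_ge0 ?subr_ge0 // (le_trans xi).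
  rewrite -/P; lra.
apply: le_trans sR _; rewrite -/P; lra.
Qed.
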